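(* There exists a universal constant $C>0$ such that the following holds. Let $H$ be a hypergraph and let $M$ be its line graph. If $\mathsf{tw}(M)\ge 8$, then there exists $\alpha\in\mathbb R_{\ge0}^{E(M)}$ such that \[ q_{M,\alpha}\in\mathcal S(H),\qquad \mathfrak B_H(q_{M,\alpha})\ge \frac49,\qquad\text{and}\qquad \max_{e\in E(H)}\alpha(\mathrm{Inc}_M(e))\le C\,\frac{\log \mathsf{tw}(M)}{\mathsf{tw}(M)}. \]
   Context: Hypergraphs $H=(V,E)$ are finite, with $E\subseteq 2^V$, and have no isolated vertices. The line graph $M$ of $H$ (equal to the primal graph $P(H^* )$ of the dual hypergraph) is the graph with vertex set $E(H)$ in which distinct $e,f\in E(H)$ are adjacent iff $e\cap f\neq\emptyset$. $\mathsf{tw}$ is treewidth. $\mathcal S(H)$ is the set of all $q:2^{E}\to\mathbb R_{\ge0}$ with $q(F)=q(E\setminus F)$ for all $F\subseteq E$. For $\alpha\in\mathbb R_{\ge0}^{E(M)}$ and $F\subseteq E(H)=V(M)$, let $\mathsf{cut}_M(F):=\{xy\in E(M): x\in F,\ y\notin F\}$ and $q_{M,\alpha}(F):=\sum_{g\in\mathsf{cut}_M(F)}\alpha_g$. For $e\in E(H)$, $\mathrm{Inc}_M(e)$ is the set of edges of $M$ incident with $e$, and $\alpha(\mathrm{Inc}_M(e)):=\sum_{g\in\mathrm{Inc}_M(e)}\alpha_g$. A branch decomposition of $E$ is a pair $(T,\delta)$ with $T$ a subcubic tree (all degrees $\le 3$) and $\delta$ a bijection from the leaves of $T$ onto $E$.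 Each $f\in E(T)$ induces a bipartition $(X_f,E\setminus X_f)$ of $E$ according to the two components of $T-f$. For $q\in\mathcal S(H)$ put $\mathfrak B_H(q):=\min_{(T,\delta)}\max_{f\in E(T)}q(X_f)$, with $\mathfrak B_H(q):=0$ if $|E|\le 1$. *)

(* Defs.v *)
From mathcomp Require Import boolp classical_sets reals exp.
From mathcomp Require Import all_boot all_order all_algebra.

Set Implicit Arguments.
Unset Strict Implicit.
Unset Printing Implicit Defensive.

Import Order.TTheory GRing.Theory Num.Theory.

(** * Simple graphs and trees *)

Record sgraph := SGraph {
  vertex :> finType;
  adj : rel vertex;
  adj_sym : symmetric adj;
  adj_irr : irreflexive adj }.

Definition edge_set (G : sgraph) : {set {set G}} :=
  [set [set x; y] | x in G, y in G & adj x y].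

Definition edge_of (G : sgraph) : finType := {g : {set G} | g \in edge_set G}.

Definition degree (G : sgraph) (x : G) : nat := #|[set y | adj x y]|.

(** Connected and acyclic; a connected graph is nonempty. [ucycle] allows the
    degenerate cycle [:: x; y] going back and forth along one edge, hence the
    bound 2. *)
Definition is_tree (T : sgraph) : Prop :=
  [/\ (0 < #|T|)%N,
      forall x y : T, connect (@adj T) x y
    & forall c : seq T, ucycle (@adj T) c -> (size c <= 2)%N].

(** * Treewidth *)

Record tree_decomp (G : sgraph) := TreeDecomp {
  td_tree : sgraph;
  td_treeP : is_tree td_tree;
  bag : td_tree -> {set G};
  td_vertex : forall v : G, exists t, v \in bag t;
  td_edge : forall u v : G, adj u v -> exists t, (u \in bag t) && (v \in bag t);
  td_connected : forall (v : G) (s t : td_tree), v \in bag s -> v \in bag t ->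
    connect [rel a b : td_tree | [&& adj a b, v \in bag a & v \in bag b]] s t }.

(** The truncated predecessor only matters for the graph without vertices,
    which gets width 0 instead of -1. *)
Definition td_width (G : sgraph) (D : tree_decomp G) : nat :=
  (\max_(t : td_tree D) #|bag t|).-1.

Lemma treewidth_exists (G : sgraph) :
  exists k, `[< exists D : tree_decomp G, td_width D = k >].
Proof.
pose T := @SGraph unit (fun _ _ => false) (fun _ _ => erefl) (fun _ => erefl).
have treeT : is_tree T.
  split; first by rewrite card_unit.
    by move=> [] [].
  by case=> [|[] [|[] c]].
have cov (v : G) : exists t : T, v \in [set: G] by exists tt; rewrite inE.
have covE (u v : G) : adj u v ->
    exists t : T, (u \in [set: G]) && (v \in [set: G]).
  by move=> _; exists tt; rewrite !inE.
have conn (v : G) (s t : T) : v \in [set: G] -> v \in [set: G] ->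
    connect [rel a b : T | [&& adj a b, v \in [set: G] & v \in [set: G]]] s t.
  by case: s; case: t.
by eexists; apply/asboolP; exists (TreeDecomp treeT cov covE conn).
Qed.

Definition tw (G : sgraph) : nat := ex_minn (treewidth_exists G).

(** * Hypergraphs and line graphs *)

Record hypergraph := Hypergraph {
  hvertex : finType;
  hedges : {set {set hvertex}};
  no_isolated : forall v, exists2 e, e \in hedges & v \in e }.

Definition hedge (H : hypergraph) : finType :=
  {e : {set hvertex H} | e \in hedges H}.

Definition line_rel (H : hypergraph) : rel (hedge H) :=
  [rel e f | (e != f) && (val e :&: val f != set0)].

Lemma line_rel_sym H : symmetric (@line_rel H).
Proof. by move=> e f; rewrite /line_rel /= eq_sym setIC. Qed.

Lemma line_rel_irr H : irreflexive (@line_rel H).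
Proof. by move=> e; rewrite /line_rel /= eqxx. Qed.

Definition line_graph (H : hypergraph) : sgraph :=
  SGraph (@line_rel_sym H) (@line_rel_irr H).

(** * Branch decompositions *)

Definition leaf (T : sgraph) : finType := {x : T | degree x == 1%N}.

Record branch_decomp (E : finType) := BranchDecomp {
  bd_tree : sgraph;
  bd_treeP : is_tree bd_tree;
  bd_subcubic : forall x : bd_tree, (degree x <= 3)%N;
  bd_leaf : leaf bd_tree -> E;
  bd_leafP : bijective bd_leaf }.

Definition del_edge (G : sgraph) (x y : G) : rel G :=
  [rel u v | adj u v && ([set u; v] != [set x; y])].

(** The elements of [E] sitting at the leaves of the component of [x] in the
    tree minus the edge [xy]. *)
Definition bd_side (E : finType) (D : branch_decomp E) (x y : bd_tree D) :
    {set E} :=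
  [set bd_leaf l | l : leaf (bd_tree D) & connect (del_edge x y) x (val l)].

Local Open Scope ring_scope.

Definition symfun (R : realType) (E : finType) (q : {set E} -> R) : Prop :=
  (forall F, 0 <= q F) /\ (forall F, q F = q (~: F)).

(** Every edge of the tree is visited in both orientations, which yields both
    sides of its bipartition; a [symfun] takes the same value on the two. *)
Definition bd_width (R : realType) (E : finType) (q : {set E} -> R)
    (D : branch_decomp E) : R :=
  \big[Num.max/0]_(xy : bd_tree D * bd_tree D | adj xy.1 xy.2)
    q (bd_side xy.1 xy.2).

(** The infimum is a minimum, see [branch_width_min]. *)
Definition branch_width (R : realType) (E : finType) (q : {set E} -> R) : R :=
  if (#|E| <= 1)%N then 0
  else inf [set w | exists D : branch_decomp E, w = bd_width q D]%classic.

Lemma branch_width_min (R : realType) (E : finType) (q : {set E} -> R)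
    (D0 : branch_decomp E) : (1 < #|E|)%N ->
  exists D : branch_decomp E, branch_width q = bd_width q D /\
    forall D' : branch_decomp E, bd_width q D <= bd_width q D'.
Proof.
move=> E_gt1; rewrite /branch_width leqNgt E_gt1 /=.
pose v (o : option {set E}) : R := if o is Some F then q F else 0.
have widthP D : exists o, bd_width q D = v o.
  rewrite /bd_width; elim/big_ind: _ => [|x y [a ->] [b ->]|xy _].
  - by exists None.
  - by rewrite /Num.max; case: ifP => _; [exists b|exists a].
  - by exists (Some (bd_side xy.1 xy.2)).
pose P o := `[< exists D : branch_decomp E, bd_width q D = v o >].
have [o0 w0] := widthP D0.
have Po0 : P o0 by apply/asboolP; exists D0.
case: (Order.TotalTheory.arg_minP v Po0) => o /asboolP[D wD] o_min.
have D_min D' : bd_width q D <= bd_width q D'.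
  have [o' w'] := widthP D'; rewrite wD w'; apply: o_min.
  by apply/asboolP; exists D'.
exists D; split=> //; apply/le_anti/andP; split.
  apply: ge_inf; last by exists D.
  by exists (bd_width q D) => _ [D' ->].
apply: lb_le_inf; first by exists (bd_width q D), D.
by move=> _ [D' ->].
Qed.

(** * Weighted cuts *)

Definition cut (G : sgraph) (F : {set G}) : {set {set G}} :=
  [set [set x; y] | x in F, y in ~: F & adj x y].

Definition cutfun (R : realType) (G : sgraph) (alpha : edge_of G -> R)
    (F : {set G}) : R :=
  \sum_(g : edge_of G | val g \in cut F) alpha g.

Definition inc_weight (R : realType) (G : sgraph) (alpha : edge_of G -> R)
    (x : G) : R :=
  \sum_(g : edge_of G | x \in val g) alpha g.

(* Main.v *)
Require Import Defs.
From mathcomp Require Import all_boot all_order all_algebra.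
From mathcomp Require Import reals exp.
From mathcomp Require Import zify ring lra.

(* Let k = tw M and s = k %/ 7. If every vertex set W of size 6s had a separator
   of fewer than s vertices leaving at most 5s vertices of W in each piece, the
   Robertson-Seymour recursion would produce a tree decomposition with bags of
   size at most 7s <= k. So fix a W without such a separator. Call F balanced if
   both F and its complement contain at least 2s vertices of W; every branch
   decomposition has an edge inducing a balanced F, so it suffices to find edge
   weights of load O(log s / s) at each vertex under which every balanced cut
   weighs at least 1. If there are none, linear programming duality gives vertex
   weights x and weights y on balanced sets such that the cut metric d of y
   satisfies d(u,v) <= x(u) + x(v) on edges, while y has much larger total weight
   than x. Balancedness makes d spread W, so growing balls in d around the
   vertices of W, each cut off by a sphere that is small compared to its volume,
   yields the excluded separator; starting volumes of about 1/|W| of the total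
   make O(log s) doublings suffice. *)

Set Implicit Arguments.
Unset Strict Implicit.
Unset Printing Implicit Defensive.

(** * Trees *)

Section ParentTree.
Variables (T : finType) (root : T) (par : T -> T) (rk : T -> nat).
Hypothesis par_lt : forall t, t != root -> (rk (par t) < rk t)%N.

(** Trees are given by a parent map that lowers a rank; both the caterpillar and the trees of tree
    decompositions are built this way. *)
Definition par_rel : rel T :=
  [rel a b | ((a != root) && (par a == b)) || ((b != root) && (par b == a))].

Lemma par_rel_sym : symmetric par_rel.
Proof. by move=> a b; rewrite /par_rel /= orbC. Qed.

Lemma par_rel_irr : irreflexive par_rel.
Proof.
move=> a; rewrite /par_rel /= orbb; apply/negbTE/negP => /andP[/par_lt lt /eqP e].
by rewrite e ltnn in lt.
Qed.

Definition par_graph : sgraph := SGraph par_rel_sym par_rel_irr.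

Lemma par_graph_up (a b : T) : par_rel a b -> (rk b <= rk a)%N -> par a = b.
Proof.
case/orP=> /andP[r /eqP e] // le; have := par_lt r; rewrite e; lia.
Qed.

Lemma par_graph_tree : is_tree par_graph.
Proof.
split; first by apply/card_gt0P; exists root.
  have toroot : forall n t, (rk t < n)%N -> connect par_rel t root.
    elim=> // n IHn t ltn; case: (eqVneq t root) => [->|tr]; first exact: connect0.
    apply: (@connect_trans _ _ (par t)).
      by apply: connect1; rewrite /par_rel /= tr eqxx.
    by apply: IHn; apply: leq_trans (par_lt tr) _.
  move=> x y; apply: (connect_trans (toroot _ x (ltnSn _))).
  by rewrite (sym_connect_sym par_rel_sym) (toroot _ y (ltnSn _)).
move=> c /andP[cyc uc]; rewrite leqNgt; apply/negP => c3.
(* both neighbours on the cycle of a vertex of maximal rank are its parent *)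
case: c cyc uc c3 => // x0 c0 cyc uc c3.
have [x xc xmax] : exists2 x, x \in x0 :: c0 &
    forall y, y \in x0 :: c0 -> (rk y <= rk x)%N.
  case: (@arg_maxnP _ x0 (mem (x0 :: c0)) rk); first exact: mem_head.
  by move=> x xc xmax; exists x => // y /xmax.
move: cyc uc c3 xmax; move: xc => /rot_to[i c' Ec].
rewrite -(rot_cycle i) -(rot_uniq i) -(size_rot i) Ec => cyc uc c3 xmax.
have xmax' y : y \in x :: c' -> (rk y <= rk x)%N.
  by rewrite -Ec mem_rot; exact: xmax.
case: c' Ec cyc uc c3 xmax' => [//|y c'] _.
case/lastP: c' => [//|c' z] /=; rewrite rcons_path last_rcons.
case/andP=> xy /andP[_ zx] uc _ xmax'.
have e1 : par x = y by apply: par_graph_up => //; apply: xmax'; rewrite !inE eqxx orbT.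
have e2 : par x = z.
  apply: par_graph_up; first by rewrite par_rel_sym.
  by apply: xmax'; rewrite !inE mem_rcons mem_head !orbT.
move: uc; rewrite /= -e1 e2 mem_rcons mem_head /=.
by rewrite andbF.
Qed.

End ParentTree.

Lemma connect_ind (U : finType) (e : rel U) (P : U -> Prop) x0 :
  P x0 -> (forall u v, connect e x0 u -> P u -> e u v -> P v) ->
  forall v, connect e x0 v -> P v.
Proof.
move=> P0 PS v /connectP[p]; elim/last_ind: p v => [|p w IHp] v /=; first by move=> _ ->.
rewrite rcons_path last_rcons => /andP[pp ew] ->.
by apply: PS ew; [apply/connectP; exists p|apply: IHp].
Qed.

Lemma eq_set2 (U : finType) (a b c d : U) : [set a; b] = [set c; d] ->
  (a = c /\ b = d) \/ (a = d /\ b = c).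
Proof.
move=> E; have /set2P ha : a \in [set c; d] by rewrite -E set21.
have /set2P hb : b \in [set c; d] by rewrite -E set22.
have /set2P hc : c \in [set a; b] by rewrite E set21.
have /set2P hd : d \in [set a; b] by rewrite E set22.
by move: ha hb hc hd => [] ? [] ? [] ? [] ?; subst; auto.
Qed.

Section Trees.
Variable T : sgraph.
Hypothesis treeT : is_tree T.
Implicit Types x y z : T.

Lemma tree_cut_edge x y : adj x y -> ~~ connect (del_edge x y) x y.
Proof.
move=> xy; apply/negP => /connectP[p0 pp0]; case: (shortenP pp0) => p pp up _ yE.
have [_ _ /(_ (x :: p))] := treeT.
have subp : path (@adj T) x p by apply: sub_path pp => a b /andP[].
rewrite /ucycle [cycle _ _]/= rcons_path subp -yE adj_sym xy up => /(_ isT).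
case: p pp yE {subp up} => [_ e|a [|b p]] //=; first by rewrite e adj_irr in xy.
by move=> /andP[/andP[_ h] _] e; rewrite -e eqxx in h.
Qed.

Lemma del_edge_sym x y : symmetric (del_edge x y).
Proof. by move=> u v; rewrite /del_edge /= adj_sym setUC. Qed.

Lemma del_edgeC x y : del_edge x y =2 del_edge y x.
Proof. by move=> u v; rewrite /del_edge /= [[set x; y]]setUC. Qed.

Lemma tree_two_sides x y z :
  connect (del_edge x y) x z || connect (del_edge x y) y z.
Proof.
have [_ /(_ x z) cxz _] := treeT.
move: z cxz; apply: connect_ind; first by rewrite connect0.
move=> u v _ IH uv; case: (eqVneq [set u; v] [set x; y]) => [/eq_set2[[_ ->]|[_ ->]]|ne].
- by rewrite connect0 orbT.
- by rewrite connect0.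
have duv : connect (del_edge x y) u v by apply: connect1; rewrite /del_edge /= uv.
by case/orP: IH => h; rewrite (connect_trans h duv) ?orbT.
Qed.

(** The component of [x] without [xy] misses [y], so it does not use the edge [yz], and [xy] joins
    it to [y]. This makes sides grow strictly when moving past [y]. *)
Lemma tree_side_grow x y z v : adj x y -> x != z ->
  connect (del_edge x y) x v -> connect (del_edge y z) y v.
Proof.
move=> xy xz; move: v; apply: connect_ind.
  apply: connect1; rewrite /del_edge /= adj_sym xy /=; apply: contra xz.
  by case/eqP/eq_set2 => [[_ ->]|[-> ->]].
move=> u v cu IH duv; apply: connect_trans IH _; apply: connect1.
have cv := connect_trans cu (connect1 duv).
case/andP: duv => uv _; rewrite /del_edge /= uv /=.
have := tree_cut_edge xy; apply: contra => /eqP/eq_set2[[e _]|[_ e]].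
  by rewrite -[X in connect _ _ X]e.
by rewrite -[X in connect _ _ X]e.
Qed.

Lemma tree_branch y v : v != y ->
  exists2 z, adj y z & connect (del_edge z y) z v.
Proof.
move=> vy; have [_ cT _] := treeT; case/connectP: (cT y v) => p0 pp0.
case: (shortenP pp0) => -[|z p] /= pp up _ vE; first by rewrite vE eqxx in vy.
case/andP: pp => yz pp; exists z => //; apply/connectP; exists p => //.
case/andP: up => yp _; have key : forall q a, y \notin a :: q ->
    path (@adj T) a q -> path (del_edge z y) a q; last exact: key.
elim=> //= b q IHq a; rewrite inE negb_or => /andP[ya ybq] /andP[ab qp].
rewrite IHq // andbT /del_edge /= ab /=; apply/negP => /eqP/eq_set2[[_ e]|[e _]].
  by rewrite e mem_head in ybq.
by rewrite e eqxx in ya.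
Qed.
End Trees.

(** * Branch decompositions *)

Section BranchDecomp.
Variables (E : finType) (D : branch_decomp E) (W : {set E}) (s : nat).
Hypotheses (s_gt0 : (0 < s)%N) (cardW : #|W| = (6 * s)%N).
Let T := bd_tree D.
Implicit Types x y z : T.

Lemma bd_leafI (e : E) : exists l : leaf T, bd_leaf l = e.
Proof. by have [g _ gK] := bd_leafP D; exists (g e). Qed.

Lemma bd_sideC x y : adj x y -> bd_side y x = ~: bd_side x y.
Proof.
move=> xy; have treeT := bd_treeP D; apply/setP => e; rewrite inE.
have [l <-] := bd_leafI e.
have inS u v : (bd_leaf l \in bd_side u v) = connect (del_edge u v) u (val l).
  rewrite /bd_side mem_imset ?inE //; exact: bij_inj (bd_leafP D).
rewrite !inS (eq_connect (del_edgeC y x)).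
case xl: (connect _ x _) (tree_two_sides treeT x y (val l)) => //= _.
apply/negbTE; apply: contra (tree_cut_edge treeT xy) => yl.
apply: connect_trans xl _.
by rewrite (sym_connect_sym (del_edge_sym _ _)).
Qed.

Let light x y := (#|W :&: bd_side x y| < 2 * s)%N.

Lemma light_or x y : adj x y -> ~~ ((2 * s <= #|W :&: bd_side x y|)%N &&
  (2 * s <= #|W :\: bd_side x y|)%N) -> light x y || light y x.
Proof.
by move=> xy; rewrite /light (bd_sideC xy) -setDE negb_and -!ltnNge.
Qed.

(* An edge whose light side is as large as possible has at its heavy end a
   vertex all of whose branches are light. *)
Lemma bd_balanced_edge : exists x y, [/\ adj x y,
  (2 * s <= #|W :&: bd_side x y|)%N & (2 * s <= #|W :\: bd_side x y|)%N].
Proof.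
have treeT := bd_treeP D.
case: (pickP [pred p : T * T | [&& adj p.1 p.2,
  (2 * s <= #|W :&: bd_side p.1 p.2|)%N & (2 * s <= #|W :\: bd_side p.1 p.2|)%N]]).
  by move=> [x y] /= /and3P[]; exists x, y.
move=> nob; exfalso.
have lightP x y : adj x y -> light x y || light y x.
  by move=> xy; apply: light_or => //; have := nob (x, y); rewrite /= xy /= => ->.
have [e We] : exists e, e \in W by apply/set0Pn; rewrite -card_gt0 cardW; lia.
have [l le] := bd_leafI e.
have [y0 ly0] : exists y, adj (val l) y.
  have : (0 < degree (val l))%N by rewrite (eqP (valP l)).
  by rewrite card_gt0 => /set0Pn[y]; rewrite inE; exists y.
pose P (p : T * T) := adj p.1 p.2 && light p.1 p.2.
have [p0 Pp0] : exists p, P p.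
  case/orP: (lightP _ _ ly0) => li; first by exists (val l, y0); rewrite /P /= ly0.
  by exists (y0, val l); rewrite /P /= adj_sym ly0.
pose sz (p : T * T) := #|[set v | connect (del_edge p.1 p.2) p.1 v]|.
case: (@arg_maxnP _ p0 P sz Pp0) => -[x y] /andP[/= xy lxy] szmax.
(* Otherwise [(y, z)] would be light with a side that also contains [y], against the maximality of
   [(x, y)]. *)
have lightN z : adj y z -> light z y.
  move=> yz; case: (eqVneq x z) => [<-//|xz].
  case/orP: (lightP _ _ yz) => // lyz.
  have := szmax (y, z); rewrite /P /= yz lyz => /(_ isT); rewrite leqNgt => /negP[].
  apply: proper_card; apply/properP; split.
    by apply/subsetP => v; rewrite !inE; apply: tree_side_grow.
  exists y; rewrite !inE ?connect0 //; exact: tree_cut_edge.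
have cover : W \subset [set e | [exists l : leaf T, (bd_leaf l == e) && (val l == y)]]
    :|: \bigcup_(z in [set z | adj y z]) (W :&: bd_side z y).
  apply/subsetP => f Wf; have [k kf] := bd_leafI f; rewrite inE.
  case: (eqVneq (val k) y) => [ky|ky].
    by apply/orP; left; rewrite inE; apply/existsP; exists k; rewrite kf ky !eqxx.
  have [z yz zk] := tree_branch treeT ky.
  apply/orP; right; apply/bigcupP; exists z; rewrite inE // Wf /= -kf.
  by apply: imset_f; rewrite inE.
have := subset_leq_card cover; rewrite cardW => le1.
have le2 : (#|\bigcup_(z in [set z | adj y z]) (W :&: bd_side z y)| <=
     degree y * (2 * s - 1))%N.
  rewrite /degree -sum_nat_const.
  apply: leq_trans (_ : \sum_(z in [set z | adj y z]) #|W :&: bd_side z y| <= _)%N.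
    elim/big_ind2: _ => [|A a B b Aa Bb|//]; first by rewrite cards0.
    by apply: leq_trans (leq_card_setU _ _) _; apply: leq_add.
  by apply: leq_sum => z; rewrite inE => /lightN; rewrite /light; lia.
have le3 := leq_trans le1 (leq_card_setU _ _).
have dy := bd_subcubic y.
set A := [set e | _] in le3.
(* A leaf [y] carries one element and has one branch: [6 * s <= 1 + (2 * s - 1)]. Any other [y]
   carries none and has at most three branches: [6 * s <= 3 * (2 * s - 1)]. Both are absurd. *)
case: (eqVneq (degree y) 1%N) => [y1|y1].
  have : (#|A| <= 1)%N.
    apply/card_le1P => f; rewrite inE => /existsP[k /andP[/eqP <- /eqP ky]] g.
    rewrite !inE; apply/existsP/eqP => [[k' /andP[/eqP <- /eqP ky']]|->].
      by congr bd_leaf; apply: val_inj; rewrite /= ky ky'.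
    by exists k; rewrite eqxx ky eqxx.
  by move: le2 le3; rewrite y1; lia.
have A0 : A = set0.
  apply/setP => f; rewrite !inE; apply/negbTE/negP => /existsP[k /andP[_ /eqP ky]].
  by have := valP k; rewrite ky (negbTE y1).
have := leq_mul dy (leqnn (2 * s - 1)); move: le2 le3; rewrite A0 cards0.
set a := (degree y * _)%N; lia.
Qed.

End BranchDecomp.

(** A caterpillar: spine vertices [(i, false)] in a row, each with a pendant [(i, true)]. With at
    least two elements every spine vertex has degree 2 or 3, so the leaves are exactly the
    pendants. *)
Lemma branch_decomp_exists (E : finType) : (1 < #|E|)%N -> inhabited (branch_decomp E).
Proof.
move=> E1; case En: #|E| E1 => [//|[//|n]] _.
pose T : finType := ('I_n.+2 * bool)%type.
pose root : T := (ord0, false).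
pose par (t : T) : T := if t.2 then (t.1, false) else (inord t.1.-1, false).
pose rk (t : T) := (2 * t.1 + t.2)%N.
have par_lt t : t != root -> (rk (par t) < rk t)%N.
  case: t => i [] //=; rewrite /rk /par /=; first by rewrite addn0 addn1.
  rewrite /root xpair_eqE andbT -val_eqE /= => i0.
  by rewrite inordK; have := ltn_ord i; lia.
pose G := par_graph par_lt.
have adjE (a b : G) : adj a b = ((a != root) && (par a == b)) || ((b != root) && (par b == a)) by [].
have adjLS (i j : 'I_n.+2) b :
    adj ((i, true) : G) ((j, b) : G) = (~~ b) && (j == i).
  rewrite adjE /par /root !xpair_eqE /= andbF /= (eq_sym j i).
  by case: b; rewrite /= ?(xpair_eqE, andbF, orbF, andbT).
have adjSS (i j : 'I_n.+2) : adj ((i, false) : G) ((j, false) : G) =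
    ((i != ord0) && (inord i.-1 == j)) || ((j != ord0) && (inord j.-1 == i)).
  by rewrite adjE /par /root !xpair_eqE /= !andbT.
have degL (i : 'I_n.+2) : degree ((i, true) : G) = 1%N.
  rewrite /degree (_ : [set _ | _] = [set ((i, false) : G)]) ?cards1 //.
  by apply/setP => -[j b]; rewrite !inE adjLS xpair_eqE; case: b; rewrite ?andbF ?andbT.
have degS_le (i : 'I_n.+2) : (degree ((i, false) : G) <= 3)%N.
  rewrite /degree; apply: leq_trans (_ : #|[:: (i, true); (inord i.-1, false);
      (inord i.+1, false)] : seq G| <= 3)%N; last exact: card_size.
  apply: subset_leq_card; apply/subsetP => -[j b]; rewrite !inE.
  case: b; first by rewrite adj_sym adjLS => /eqP->; rewrite eqxx.
  rewrite adjSS => /orP[]/andP[j0 /eqP <-]; first by rewrite eqxx orbT.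
  have ej : j = inord (inord j.-1 : 'I_n.+2).+1.
    apply: ord_inj; have := ltn_ord j; move: j0; rewrite -val_eqE /= => j0 jn.
    by rewrite !inordK; lia.
  by rewrite -ej eqxx !orbT.
have degS_ge (i : 'I_n.+2) : (2 <= degree ((i, false) : G))%N.
  pose k : 'I_n.+2 := if i == 0%N :> nat then inord 1 else inord i.-1.
  apply: leq_trans (_ : #|[set (i, true); (k, false)] : {set G}| <= _)%N.
    by rewrite cards2 xpair_eqE andbF.
  apply: subset_leq_card; apply/subsetP => t; rewrite !inE.
  case/orP=> /eqP->; first by rewrite adj_sym adjLS eqxx.
  rewrite adjSS /k -!val_eqE /=; case: eqP => [i0|_]; last by rewrite eqxx.
  by rewrite -?val_eqE /= ?inordK ?i0 //= ?inordK.
have leafP (l : leaf G) : val l = ((val l).1, true).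
  case: l => -[i b] /= d; case: b d => // d.
  by have := degS_ge i; rewrite (eqP d).
pose f (l : leaf G) : E := enum_val (cast_ord (esym En) (val l : G).1).
pose g (e : E) : leaf G := Sub ((cast_ord En (enum_rank e), true) : G)
   (introT eqP (degL _)).
constructor; apply: (@BranchDecomp E G (par_graph_tree par_lt) _ f).
  by case=> i [] //; rewrite degL.
exists g => [l|e]; last by rewrite /f /= cast_ordK enum_rankK.
by apply: val_inj; rewrite /= [RHS]leafP /f enum_valK cast_ordKV.
Qed.

(** * Tree decompositions from separators *)

Section TreeDecompLists.
Variable G : sgraph.
Implicit Types (l : seq (nat * {set G})) (U W S X : {set G}).

Definition nodes_cover l : {set G} := [set v : G | has (fun p : nat * {set G} => v \in p.2) l].
Definition node_par l i : nat := (nth (0, set0) l i).1.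
Definition node_bag l i : {set G} := (nth (0, set0) l i).2.

(* A list of nodes (parent, bag), where a vertex of a bag that occurs earlier
   in the list already occurs in the bag of the parent. *)
Definition tree_nodes l := forall i, 0 < i < size l ->
  node_par l i < i /\ node_bag l i :&: nodes_cover (take i l) \subset node_bag l (node_par l i).

Lemma nodes_cover_cat l1 l2 :
  nodes_cover (l1 ++ l2) = nodes_cover l1 :|: nodes_cover l2.
Proof. by apply/setP => v; rewrite !inE has_cat. Qed.

Lemma tree_nodes_rcons l p X : tree_nodes l -> p < size l ->
  X :&: nodes_cover l \subset node_bag l p -> tree_nodes (rcons l (p, X)).
Proof.
move=> tl pl XW i; rewrite size_rcons => /andP[i0].
rewrite ltnS leq_eqVlt => /predU1P[ei|il].
  rewrite /node_par /node_bag ei !nth_rcons ltnn eqxx /= pl.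
  by rewrite -cats1 take_size_cat.
have [pi sub] := tl i (introT andP (conj i0 il)).
rewrite /node_par /node_bag !nth_rcons il /= -/(node_par l i) (ltn_trans pi il).
by rewrite -cats1 takel_cat // ltnW.
Qed.

Lemma node_bagP l v : reflect (exists2 i, i < size l & v \in node_bag l i) (v \in nodes_cover l).
Proof. by rewrite inE; apply: (iffP (has_nthP (0, set0))) => -[i]; exists i. Qed.

Lemma tree_nodes_decomp l w : l <> [::] -> tree_nodes l ->
  (forall v, v \in nodes_cover l) ->
  (forall u v, adj u v -> exists2 p, p \in l & (u \in p.2) && (v \in p.2)) ->
  (forall p, p \in l -> #|p.2| <= w) -> tw G <= w.-1.
Proof.
move=> l0 tl cov edg szl; case En: (size l) => [|n].
  by rewrite (size0nil En) in l0.
pose par (t : 'I_n.+1) : 'I_n.+1 := inord (node_par l t).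
have par_val (t : 'I_n.+1) : t != ord0 -> (par t = node_par l t :> nat) /\
    (node_par l t < t) /\
    node_bag l t :&: nodes_cover (take t l) \subset node_bag l (node_par l t).
  move=> t0; have [|h sub] := tl t.
    by rewrite En ltn_ord andbT lt0n.
  by split=> //; rewrite inordK // (ltn_trans h).
have par_lt t : t != ord0 -> par t < t by case/par_val=> -> [].
pose T := par_graph par_lt; pose bg (t : T) := node_bag l (t : 'I_n.+1).
have nodeI i : i < size l -> exists t : T, bg t = node_bag l i.
  by rewrite En => ln; exists (Ordinal ln).
have tdv (v : G) : exists t, v \in bg t.
  have /node_bagP[i il vi] := cov v; have [t bt] := nodeI i il.
  by exists t; rewrite bt.
have tde (u v : G) : adj u v -> exists t, (u \in bg t) && (v \in bg t).
  case/edg=> p /(nthP (0, set0))[i il ip] uv; have [t bt] := nodeI i il.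
  by exists t; rewrite bt /node_bag ip.
have tdc (v : G) (s t : T) : v \in bg s -> v \in bg t ->
    connect [rel a b : T | [&& adj a b, v \in bg a & v \in bg b]] s t.
  set r := [rel a b : T | _].
  have symr : symmetric r.
    move=> a b; apply/and3P/and3P => -[ab va vb]; split=> //.
      exact: etrans (@adj_sym T b a) ab.
    exact: etrans (@adj_sym T a b) ab.
  move=> vs vt.
  (* [f] is the first node containing [v]. Any later node containing [v] has a parent containing
     [v], so climbing parents ends at [f]. *)
  have [f vf fmin] : exists2 f : T, v \in bg f & forall t : T, v \in bg t -> (f : 'I_n.+1) <= (t : 'I_n.+1).
    by case: (@arg_minnP _ s (fun t => v \in bg t) (fun t : T => (t : 'I_n.+1) : nat) vs) => f; exists f.
  have tof : forall m (t : T), (t : 'I_n.+1) < m -> v \in bg t -> connect r t f.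
    elim=> // m IHm a am va; case: (eqVneq a f) => [->|af]; first exact: connect0.
    have fa : (f : 'I_n.+1) < (a : 'I_n.+1).
      rewrite ltn_neqAle fmin // andbT eq_sym.
      by apply: contra af => /eqP/val_inj->.
    have a0 : (a : 'I_n.+1) != ord0 by rewrite -val_eqE /= -lt0n; apply: leq_ltn_trans fa.
    have [e [lt sub]] := par_val _ a0.
    have vp : v \in bg (par a).
      rewrite /bg e; apply: (subsetP sub); rewrite inE va /=; apply/node_bagP.
      exists (f : 'I_n.+1); first by rewrite size_take En ltn_ord.
      by rewrite /node_bag nth_take.
    apply: connect_trans (_ : connect r (par a) f).
      apply/connect1/and3P; split=> //; change (par_rel ord0 par a (par a)).
      by rewrite /par_rel /= a0 eqxx.
    by apply: IHm => //; rewrite e (leq_trans lt).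
  apply: connect_trans (tof _ s (ltnSn _) vs) _.
  by rewrite (sym_connect_sym symr) (tof _ t (ltnSn _) vt).
pose D := TreeDecomp (par_graph_tree par_lt) tdv tde tdc.
rewrite /tw; case: ex_minnP => k _ kmin.
apply: leq_trans (kmin (td_width D) _) _; first by apply/boolp.asboolP; exists D.
rewrite /td_width -!subn1 leq_sub2r //; apply/bigmax_leqP => t _.
by apply: szl; apply: mem_nth; rewrite En ltn_ord.
Qed.

Lemma set_interpolate (T : finType) (A B : {set T}) k : A \subset B ->
  #|A| <= k <= #|B| -> exists C : {set T}, [/\ A \subset C, C \subset B & #|C| = k].
Proof.
move=> AB /andP[]; elim: k => [|k IHk] Ak kB.
  by exists A; split=> //; apply/eqP; rewrite -leqn0.
move: Ak; rewrite leq_eqVlt => /predU1P[Ak|Ak]; first by exists A.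
have [C [AC CB Ck]] := IHk Ak (ltnW kB).
have /properP[_ [x xB xC]] : C \proper B by rewrite properEcard CB Ck.
exists (x |: C); split; first exact: subset_trans AC (subsetUr _ _).
  by rewrite subUset sub1set xB.
by rewrite cardsU1 xC Ck.
Qed.

Section Separators.
Variable s : nat.
(** The labelling [c] encodes the pieces: each label class outside [S] is a union of components of
    the graph minus [S]. *)
Hypothesis separators : forall W, #|W| = 6 * s -> exists S (c : G -> nat),
  [/\ #|S| < s,
      forall u v, adj u v -> u \notin S -> v \notin S -> c u = c v &
      forall i, #|[set v in W | (v \notin S) && (c v == i)]| <= 5 * s].

(** Robertson-Seymour recursion: [U] is still to be decomposed, and [W] is its interface with the
    nodes already placed, contained in bag [i]. A new bag [W' :|: SU] has size below [7 * s], and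
    each piece inherits an interface of size at most [5 * s] plus that of the separator, again below
    [6 * s]. *)
Lemma separators_extend N l i U W : #|U :\: W| < N -> tree_nodes l -> i < size l ->
  W \subset node_bag l i -> W \subset U -> U :&: nodes_cover l \subset W ->
  #|W| < 6 * s ->
  exists l', [/\ tree_nodes (l ++ l'), forall p, p \in l' -> #|p.2| <= 7 * s,
    nodes_cover l' = U &
    forall u v, adj u v -> u \in U -> v \in U ->
      exists2 p, p \in l' & (u \in p.2) && (v \in p.2)].
Proof.
elim: N l i U W => // N IHN l i U W; rewrite ltnS => UW tl il Wi WU UlW cW.
have Ui X : X \subset U -> X :&: nodes_cover l \subset node_bag l i.
  by move=> XU; apply: subset_trans Wi; apply: subset_trans UlW; apply: setSI.
have [Us|Us] := leqP #|U| (7 * s).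
  exists [:: (i, U)]; split.
  - by rewrite cats1; apply: tree_nodes_rcons => //; apply: Ui.
  - by move=> p; rewrite inE => /eqP->.
  - by apply/setP => v; rewrite !inE /= orbF.
  - by move=> u v _ uU vU; exists (i, U); rewrite ?mem_head // uU vU.
(* Filling [W] up to size exactly [6 * s] makes the hypothesis applicable; as [W] was smaller, the
   measure [#|U :\: W|] drops. *)
have [|W' [WW' W'U cW']] := @set_interpolate _ W U (6 * s) WU; first by lia.
have [S [c [cS adjc cc]]] := separators cW'.
pose SU := S :&: U; pose X := W' :|: SU.
pose P j := [set v in U | (v \notin S) && (c v == j)].
have cSU : #|SU| <= #|S| by apply/subset_leq_card/subsetIl.
have XU : X \subset U by rewrite subUset W'U subsetIr.
have tl1 : tree_nodes (rcons l (i, X)) by apply: tree_nodes_rcons => //; apply: Ui.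
have lt : #|U :\: W'| < #|U :\: W|.
  by have := cardsD U W; have := cardsD U W'; rewrite !(setIidPr _) //; have := subset_leq_card W'U; lia.
(* The pieces with labels below [j] are decomposed one after the other, each attached to the node
   with bag [X]. *)
have step j : exists l2, [/\ tree_nodes (rcons l (i, X) ++ l2),
    forall p, p \in l2 -> #|p.2| <= 7 * s,
    forall v, v \in nodes_cover l2 = [exists k : 'I_j, v \in P k :|: SU] &
    forall u v k, adj u v -> k < j -> u \in P k :|: SU -> v \in P k :|: SU ->
      exists2 p, p \in l2 & (u \in p.2) && (v \in p.2)].
  elim: j => [|j [l2 [tl2 sz2 cov2 edg2]]].
    exists [::]; split=> //; first by rewrite cats0.
    by move=> v; rewrite inE; apply/esym/existsP => -[[]].
  have szl : size l < size (rcons l (i, X) ++ l2) by rewrite size_cat size_rcons; lia.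
  have bagl : node_bag (rcons l (i, X) ++ l2) (size l) = X.
    by rewrite /node_bag nth_cat size_rcons ltnSn nth_rcons ltnn eqxx.
  have [|||||l3 [tl3 sz3 cov3 edg3]] := IHN (rcons l (i, X) ++ l2) (size l)
      (P j :|: SU) ((P j :&: W') :|: SU) _ tl2 szl.
  - apply: leq_trans UW; apply: leq_ltn_trans lt; apply: subset_leq_card.
    by apply/subsetP => v; rewrite !inE; case: (v \in S); case: (v \in U); case: (v \in W'); case: (c v == j).
  - by rewrite bagl; apply: setSU; apply: subsetIr.
  - by apply: setSU; apply: subsetIl.
  (* A vertex of piece [j] outside [SU] that occurred before lies in [W] if it is in [l], in [W'] if
     it is in [X], and cannot lie in an earlier piece, whose label differs. *)
  - apply/subsetP => v /setIP[vP].
    rewrite -cats1 !nodes_cover_cat => vc; rewrite in_setU in_setI.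
    case: (boolP (v \in SU)) => vS; rewrite ?orbT // orbF.
    move: vP; rewrite in_setU (negbTE vS) orbF => vP; rewrite vP /=.
    move: vc; rewrite 2!in_setU cov2 -orbA => /or3P[vl|vX|/existsP[k]].
    + apply: (subsetP WW'); apply: (subsetP UlW); rewrite inE vl andbT.
      by move: vP; rewrite inE => /andP[].
    + by move: vX; rewrite inE /= orbF in_setU (negbTE vS) orbF.
    + rewrite in_setU (negbTE vS) orbF => vk.
      move: vP vk; rewrite !inE => /and3P[_ _ /eqP cj] /and3P[_ _ /eqP ck].
      by have := ltn_ord k; rewrite -[X in X < _]ck cj ltnn.
  - apply: leq_ltn_trans (leq_card_setU _ _) _.
    have : #|P j :&: W'| <= 5 * s; last by lia.
    apply: leq_trans (cc j); apply: subset_leq_card; apply/subsetP => v.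
    by rewrite !inE => /andP[/andP[_ ->] ->].
  exists (l2 ++ l3); split; first by rewrite catA.
  - by move=> p; rewrite mem_cat => /orP[/sz2|/sz3].
  - move=> v; rewrite nodes_cover_cat in_setU cov2 cov3; apply/orP/existsP.
      case=> [/existsP[k vk]|vj]; last by exists ord_max.
      by exists (widen_ord (leqnSn j) k).
    case=> k vk; have := ltn_ord k; rewrite ltnS leq_eqVlt => /predU1P[kj|kj].
      by right; rewrite -kj.
    by left; apply/existsP; exists (Ordinal kj).
  - move=> u v k uv; rewrite ltnS leq_eqVlt => /predU1P[->|kj] hu hv.
      by have [p pl puv] := edg3 u v uv hu hv; exists p; rewrite // mem_cat pl orbT.
    by have [p pl puv] := edg2 u v k uv kj hu hv; exists p; rewrite // mem_cat pl.
pose m := \max_v c v.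
have cm v : c v < m.+1 by rewrite ltnS; apply: leq_bigmax.
have [l2 [tl2 sz2 cov2 edg2]] := step m.+1.
exists ((i, X) :: l2); split; first by rewrite -cat_rcons.
- move=> p; rewrite inE => /predU1P[->/=|/sz2//].
  by apply: leq_trans (leq_card_setU _ _) _; lia.
- apply/setP => v; rewrite -cat1s nodes_cover_cat in_setU cov2.
  rewrite [v \in nodes_cover [:: _]]inE /= orbF; apply/orP/idP.
    case=> [/(subsetP XU)//|/existsP[k]]; rewrite !inE.
    by case/orP=> /andP[].
  move=> vU; right; apply/existsP; exists (Ordinal (cm v)).
  by rewrite !inE vU eqxx /=; case: (v \in S).
- move=> u v uv uU vU.
  have [k km [hu hv]] : exists2 k, k < m.+1 & u \in P k :|: SU /\ v \in P k :|: SU.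
    case: (boolP (u \in S)) => uS.
      exists (c v) => //; rewrite !inE uU uS vU eqxx /= ?orbT; split=> //.
      by case: (v \in S).
    exists (c u) => //; rewrite !inE uU (negbTE uS) vU eqxx /=; split=> //.
    by case: (boolP (v \in S)) => //= vS; rewrite (adjc u v) // eqxx.
  by have [p pl puv] := edg2 u v k uv km hu hv; exists p => //; apply/predU1r.
Qed.

Lemma tw_separators : 0 < s -> tw G <= (7 * s).-1.
Proof.
(* A root with empty bag gives the recursion a node to attach to. *)
move=> s0; pose l0 := [:: (0, set0 : {set G})].
have tl0 : tree_nodes l0 by move=> [|[]].
have [|||||l [tl sz cov edg]] := @separators_extend (#|[set: G] :\: set0|).+1 l0 0 setT set0 _ tl0 isT.
- exact: ltnSn.
- exact: sub0set.
- exact: sub0set.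
- by apply/subsetP => v; rewrite !inE /= inE.
- by rewrite cards0; lia.
apply: (tree_nodes_decomp (l := l0 ++ l)) => // [v|u v uv|p].
- by rewrite nodes_cover_cat cov !inE orbT.
- by have [||p pl puv] := edg u v uv; rewrite ?inE //; exists p; rewrite // mem_cat pl orbT.
- by rewrite mem_cat => /orP[|/sz//]; rewrite inE => /eqP->; rewrite cards0.
Qed.
End Separators.
End TreeDecompLists.

(** * Region growing in a cut metric *)

Section CutMetric.
Variables (V : finType) (y : {set V} -> nat).

Definition cut_dist (u v : V) : nat := \sum_F y F * ((u \in F) != (v \in F)).

Lemma cut_dist0 u : cut_dist u u = 0.
Proof. by rewrite /cut_dist big1 // => F _; rewrite eqxx muln0. Qed.

Lemma cut_dist_triangle u v w : cut_dist u w <= cut_dist u v + cut_dist v w.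
Proof.
rewrite /cut_dist -big_split /=; apply: leq_sum => F _; rewrite -mulnDr leq_mul2l.
by case: (u \in F); case: (v \in F); case: (w \in F); rewrite ?orbT.
Qed.

(** Each [F] of positive weight has at most [a] elements of [P] on the side of [w], hence separates
    [w] from all the others. *)
Lemma cut_dist_spread (W P : {set V}) a (w : V) :
  (forall F, 0 < y F -> #|W :&: F| <= a /\ #|W :\: F| <= a) ->
  P \subset W -> (\sum_F y F) * (#|P| - a) <= \sum_(v in P) cut_dist w v.
Proof.
move=> ya PW; rewrite /cut_dist exchange_big /= big_distrl /=; apply: leq_sum => F _.
rewrite -big_distrr /= leq_mul2l; case: (posnP (y F)) => //= y0.
have [ha hb] := ya F y0.
have : #|P| <= #|[set v in P | (w \in F) != (v \in F)]| + a.
  rewrite -(cardsID [set v | (w \in F) != (v \in F)] P); apply: leq_add.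
    by apply: subset_leq_card; apply/subsetP => v; rewrite !inE.
  case wF: (w \in F); [apply: leq_trans ha|apply: leq_trans hb]; apply: subset_leq_card;
    apply/subsetP => v; rewrite !inE; case: (v \in F) => //= /(subsetP PW)-> //.
rewrite leq_subLR addnC; congr (_ <= _ + _).
rewrite -sum1dep_card big_mkcondr /=; apply: eq_bigr => v _.
by case: (_ != _).
Qed.
End CutMetric.

Section RegionGrowing.
Variables (G : sgraph) (x : G -> nat) (d : G -> G -> nat).
Hypothesis d0 : forall u, d u u = 0.
Hypothesis dtri : forall u v w, d u w <= d u v + d v w.
Hypothesis dx : forall u v, adj u v -> d u v <= x u + x v.
Implicit Types (U W S : {set G}).

(** A vertex [v] occupies the interval from [d w v - x v] (excluded) to [d w v + x v] (included).
    The ball collects the intervals ending before [r], the sphere those containing [r]. *)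
Definition ball U w r := [set v in U | d w v + x v < r].
Definition sphere U w r := [set v in U | (d w v < r + x v) && (r <= d w v + x v)].

(** By [dx], the interval of [v] starts before that of [u] ends, hence before [r]; off the sphere it
    must also end before [r]. *)
Lemma sphere_separates U w r u v : adj u v -> u \in ball U w r ->
  v \in U -> v \notin sphere U w r -> v \in ball U w r.
Proof.
move=> uv; rewrite !inE => /andP[uU ur] vU; rewrite vU /=.
have := dx uv; have := dtri w u v; lia.
Qed.

Lemma interval_count a n t : \sum_(1 <= r < n.+1) ((a < r + t) && (r <= a + t)) <= 2 * t.
Proof.
(* Truncation in [a - t] is right because radii start at 1. *)
have key k : \sum_(1 <= r < k.+1) ((a < r + t) && (r <= a + t)) <= minn k (a + t) - (a - t).
  elim: k => [|k IHk]; first by rewrite big_geq.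
  rewrite big_nat_recr //=; move: IHk; case: (_ && _) / andP; lia.
apply: leq_trans (key n) _; lia.
Qed.

(** Double counting: [v] lies on at most [2 * x v] spheres, and on none of radius up to [r] unless
    its interval starts before [r]. *)
Lemma sphere_volume U w r :
  \sum_(1 <= i < r.+1) #|sphere U w i| <= \sum_(v in ball U w r :|: sphere U w r) 2 * x v.
Proof.
rewrite (eq_bigr (fun i => \sum_(v in U) ((d w v < i + x v) && (i <= d w v + x v)))); last first.
  by move=> i _; rewrite -sum1dep_card big_mkcondr /=; apply: eq_bigr => v _; case: (_ && _).
rewrite exchange_big /= (bigID (mem (ball U w r :|: sphere U w r))) /=.
rewrite [X in _ + X]big1 ?addn0.
  rewrite big_mkcond [X in _ <= X]big_mkcond; apply: leq_sum => v _.
  rewrite andbC; case: (v \in _ :|: _) => //=; case: (v \in U) => //.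
  exact: interval_count.
move=> v /andP[vU]; rewrite !inE vU /= => vr.
rewrite big_nat big1 // => i ir; apply/eqP; rewrite eqb0; lia.
Qed.

(* Along each of [L] successive blocks of [B] radii where every sphere is too
   large, the volume doubles. *)
Lemma region_radius U w (beta X B L : nat) : 0 < B -> \sum_(v in U) x v <= X ->
  beta + 2 * X + 1 < 2 ^ L * (beta + 1) ->
  exists r, [/\ 0 < r, r <= B * L &
    #|sphere U w r| * B <= beta + \sum_(v in ball U w r :|: sphere U w r) 2 * x v].
Proof.
move=> B0 UX bX; pose vol r := beta + \sum_(1 <= i < r.+1) #|sphere U w i|.
have volX r : vol r <= beta + 2 * X.
  rewrite leq_add2l; apply: leq_trans (sphere_volume U w r) _.
  rewrite -big_distrr /= leq_mul2l /=; apply: leq_trans UX.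
  rewrite [X in X <= _]big_mkcond [X in _ <= X]big_mkcond /=; apply: leq_sum => v _.
  by rewrite !inE; case: (v \in U) => //=; case: ifP.
have volS r : vol r.+1 = vol r + #|sphere U w r.+1|.
  by rewrite /vol big_nat_recr //= addnA.
have vol_mono r n : vol r <= vol (r + n).
  by elim: n => [|n IHn]; rewrite ?addn0 // addnS volS (leq_trans IHn) ?leq_addr.
case: (boolP [exists r : 'I_(B * L).+1, (0 < r) && (#|sphere U w r| * B <= vol r.-1)]).
  case/existsP=> -[r /= rB] /andP[r0 h]; exists r; split=> //.
  apply: leq_trans h _; rewrite leq_add2l prednK //.
  apply: leq_trans (sphere_volume U w r); rewrite [X in _ <= X]big_nat_recr //=.
  by rewrite -[X in \sum_(1 <= i < X) _](prednK r0) leq_addr.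
rewrite negb_exists => /forallP big; exfalso.
have bigP r : r < B * L -> vol r < #|sphere U w r.+1| * B.
  by move=> rB; have := big (Ordinal (rB : r.+1 < (B * L).+1)); rewrite /= -ltnNge.
have grow k : k <= L -> 2 ^ k * (beta + 1) <= vol (B * k) + 1.
  elim: k => [|k IHk] kL; first by rewrite muln0 /vol big_geq // expn0; lia.
  (* Every sphere in the block has size times [B] at least [vol (B * k) + 1], so [B] of them double
     [vol + 1]. The added 1 lets the doubling start even when [beta] is 0. *)
  have inner n : n <= B -> (vol (B * k) + 1) * n <= (vol (B * k + n) - vol (B * k)) * B.
    elim: n => [|n IHn] nB; first by rewrite muln0.
    have lt : B * k + n < B * L by have := leq_mul (leqnn B) kL; rewrite mulnS; lia.
    have := IHn (ltnW nB); have := bigP _ lt; have := vol_mono (B * k) n.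
    rewrite [(B * k + n.+1)%N]addnS volS; nia.
  have := inner B (leqnn _); rewrite leq_pmul2r // mulnS (addnC B).
  have := vol_mono (B * k) B; have := IHk (ltnW kL); rewrite expnS; lia.
have := grow L (leqnn _); have := volX (B * L); lia.
Qed.

(** Cut a ball around some [w] of [W] out of [U] together with its sphere, and recurse on the rest.
    Each round spends one vertex of [W], paid by [beta], and a volume disjoint from later ones; once
    [W] is used up, the remainder is left uncut. *)
Lemma region_growing (W : {set G}) (beta X B L a : nat) : 0 < B ->
  \sum_v x v <= X -> beta + 2 * X + 1 < 2 ^ L * (beta + 1) ->
  (forall w, #|[set v in W | d w v < B * L]| <= a) ->
  forall U, exists S (c : G -> nat), [/\ S \subset U,
    #|S| * B <= beta * #|W :&: U| + \sum_(v in U) 2 * x v,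
    forall u v, adj u v -> u \in U :\: S -> v \in U :\: S -> c u = c v &
    forall i, #|[set v in W | (v \in U :\: S) && (c v == i)]| <= a].
Proof.
move=> B0 xX bX small U; move En: #|U| => n; elim/ltn_ind: n U En => n IHn U En.
case: (set_0Vmem (W :&: U)) => [WU0|[w]].
  exists set0, (fun=> 0); split=> //; rewrite ?sub0set ?cards0 //.
  move=> i; rewrite (_ : [set _ in _ | _] = set0) ?cards0 //; apply/setP => v.
  by have /setP/(_ v) := WU0; rewrite !inE; case: (v \in W) => //= ->.
rewrite inE => /andP[wW wU].
have UX : \sum_(v in U) x v <= X.
  by apply: leq_trans xX; rewrite big_mkcond; apply: leq_sum => v _; case: ifP.
have [r [r0 rB hr]] := region_radius w B0 UX bX.
set In := ball U w r in hr *; set Sr := sphere U w r in hr *.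
have InU : In \subset U by apply/subsetP => v; rewrite inE => /andP[].
have SrU : Sr \subset U by apply/subsetP => v; rewrite inE => /andP[].
pose A := In :|: Sr.
have AU : A \subset U by rewrite subUset InU SrU.
have wA : w \in A by rewrite !inE wU d0 /=; lia.
have [|S [c [SU cS adjc cc]]] := IHn #|U :\: A| _ (U :\: A) erefl.
  rewrite -En; apply: proper_card; apply/properP.
  by split; [apply: subsetDl|exists w => //; rewrite in_setD wA].
(* The new ball takes label 0 and the labels of the recursive call move up by one. *)
exists (Sr :|: S), (fun v => if v \in In then 0 else (c v).+1); split.
- by rewrite subUset SrU (subset_trans SU) ?subsetDl.
- apply: leq_trans (_ : (#|Sr| + #|S|) * B <= _); first by rewrite leq_mul2r leq_card_setU orbT.
  have e1 : \sum_(v in U) 2 * x v = \sum_(v in A) 2 * x v + \sum_(v in U :\: A) 2 * x v.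
    by rewrite [LHS](big_setID A) /= (setIidPr AU).
  have e2 : #|W :&: (U :\: A)| < #|W :&: U|.
    apply: proper_card; apply/properP; split; first by rewrite setIS ?subsetDl.
    by exists w; rewrite in_setI ?in_setD wW ?wU // wA.
  have := leq_mul (leqnn beta) e2; rewrite mulnDl e1 mulnS; move: hr cS; rewrite -/A; lia.
- have key u v : adj u v -> u \in In -> v \in U -> v \notin Sr -> v \in In.
    by move=> uv uI vU vS; apply: sphere_separates uv uI vU vS.
  move=> u v uv; rewrite !in_setD !in_setU !negb_or -!andbA => /and3P[uSr uS uU] /and3P[vSr vS vU].
  case: (boolP (u \in In)) => uI; first by rewrite (key u v).
  case: (boolP (v \in In)) => vI; first by rewrite (key v u) // adj_sym in uI.
  by congr (_.+1); apply: adjc => //; rewrite in_setD ?uS ?vS in_setD in_setU negb_or ?uI ?uSr ?vI ?vSr.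
- case=> [|i].
    apply: leq_trans (small w); apply: subset_leq_card; apply/subsetP => v.
    rewrite !inE => /and3P[-> _ ]; case: ifP => //=; lia.
  apply: leq_trans (cc i); apply: subset_leq_card; apply/subsetP => v.
  rewrite in_set [in X in _ -> X]in_set in_setD in_setU negb_or.
  case/and3P=> -> /andP[/andP[vSr vS] vU]; case: ifP => // vI; rewrite eqSS => ->.
  by rewrite !in_setD in_setU vS vU vI (negbTE vSr).
Qed.
End RegionGrowing.

Import Order.TTheory GRing.Theory Num.Theory.
Local Open Scope ring_scope.

(** * Farkas' lemma *)

Lemma interval_point (F : realFieldType) (I : finType) (P Q : pred I) (l u : I -> F) :
  (forall i k, P i -> Q k -> l k <= u i) ->
  exists t, (forall i, P i -> t <= u i) /\ (forall k, Q k -> l k <= t).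
Proof.
move=> lu; case: (pickP Q) => [k0 Qk0|noQ].
  case: (arg_maxP l Qk0) => k Qk kmax; exists (l k); split=> // i Pi; exact: lu.
case: (pickP P) => [i0 Pi0|noP].
  case: (arg_minP u Pi0) => i Pi imin; exists (u i); split=> // k.
  by rewrite noQ.
by exists 0; split=> i; rewrite ?noQ ?noP.
Qed.

(* Fourier-Motzkin elimination of the variables one at a time *)
Lemma farkas (F : realFieldType) (J : eqType) (s : seq J) : uniq s ->
  forall (I : finType) (A : I -> J -> F) (b : I -> F),
  (exists a : J -> F, forall i, \sum_(j <- s) A i j * a j <= b i) \/
  (exists z : I -> F, [/\ forall i, 0 <= z i,
     forall j, j \in s -> \sum_i z i * A i j = 0 & \sum_i z i * b i < 0]).
Proof.
elim: s => [_|j0 s IHs /= /andP[j0s us]] I A b.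
  case: (pickP (fun i => b i < 0)) => [i0 bi0|nob].
    right; exists (fun i => (i == i0)%:R); split=> [i|//|]; first exact: ler0n.
    rewrite (bigD1 i0) //= big1 ?eqxx ?mul1r ?addr0 // => i /negbTE->.
    by rewrite mul0r.
  by left; exists (fun=> 0) => i; rewrite big_nil leNgt nob.
(* A row with positive and a row with negative coefficient at [j0] are combined so that [j0]
   cancels. Any other pair yields its first row if [j0] is absent there, and the void row [0 <= 0]
   otherwise. *)
pose ok (p : I * I) := (0 < A p.1 j0) && (A p.2 j0 < 0).
pose lam p := if ok p then - A p.2 j0 else (A p.1 j0 == 0)%:R.
pose mu p := if ok p then A p.1 j0 else 0.
have lam0 p : 0 <= lam p.
  rewrite /lam; case: ifP => [/andP[_ /ltW]|_]; last exact: ler0n.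
  by rewrite oppr_ge0.
have mu0 p : 0 <= mu p by rewrite /mu; case: ifP => // /andP[/ltW].
have elim p : lam p * A p.1 j0 + mu p * A p.2 j0 = 0.
  rewrite /lam /mu; case: ifP => _; first by ring.
  by case: eqP => [->|_]; rewrite ?mulr0 ?mul0r add0r.
pose A' p j := lam p * A p.1 j + mu p * A p.2 j.
pose b' p := lam p * b p.1 + mu p * b p.2.
case: (IHs us _ A' b') => [[a ha]|[z [z0 zA zb]]].
  left; pose r i := b i - \sum_(j <- s) A i j * a j.
  have rP p : 0 <= lam p * r p.1 + mu p * r p.2.
    have := ha p; rewrite -subr_ge0 /b' /A' => H; apply: le_trans H _.
    rewrite (eq_bigr (fun j => lam p * (A p.1 j * a j) + mu p * (A p.2 j * a j))).
      by rewrite big_split /= -!mulr_sumr /r !mulrBr; lra.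
    by move=> j _; ring.
  have [t [tu lt]] : exists t, (forall i, 0 < A i j0 -> t <= r i / A i j0) /\
     (forall k, A k j0 < 0 -> r k / A k j0 <= t).
    apply: interval_point => i k Ai Ak.
    have := rP (i, k); rewrite /lam /mu /ok /= Ai Ak /= => H.
    by rewrite ler_pdivlMr // mulrAC ler_ndivrMr //; lra.
  exists (fun j => if j == j0 then t else a j) => i.
  rewrite big_cons eqxx (eq_big_seq (fun j => A i j * a j)); last first.
    by move=> j js; case: eqP => // ej; rewrite -ej js in j0s.
  rewrite -lerBrDr -/(r i); case: (ltgtP (A i j0) 0) => Ai.
  - by have := lt i Ai; rewrite ler_ndivrMr // mulrC.
  - by have := tu i Ai; rewrite ler_pdivlMr // mulrC.
  - have := rP (i, i).
    by rewrite /lam /mu /ok /= Ai ltxx eqxx /= !mul0r mul1r addr0.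
(* The multiplier of an original row gathers its shares in all combined rows, as first and as second
   member. *)
right; pose w i := \sum_k z (i, k) * lam (i, k) + \sum_k z (k, i) * mu (k, i).
have wE f : \sum_i w i * f i = \sum_p z p * (lam p * f p.1 + mu p * f p.2).
  rewrite (eq_bigr (fun i => \sum_k z (i, k) * lam (i, k) * f i +
      \sum_k z (k, i) * mu (k, i) * f i)); last first.
    by move=> i _; rewrite mulrDl !mulr_suml.
  rewrite big_split /= [X in _ + X]exchange_big /= -big_split /=.
  under eq_bigr do rewrite -big_split /=.
  by rewrite pair_bigA; apply: eq_bigr => -[i k] _ /=; ring.
exists w; split=> [i|j|]; last by rewrite wE.
  by rewrite addr_ge0 // sumr_ge0 // => k _; rewrite mulr_ge0.
rewrite inE wE => /predU1P[->|js]; last exact: zA.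
by rewrite big1 // => p _; rewrite elim mulr0.
Qed.

(** The product of all denominators serves as common multiple. It makes the dual solution integral,
    so that regions grow over integer radii. *)
Lemma clear_denominators (I : finType) (z : I -> rat) : (forall i, 0 <= z i) ->
  exists (N : nat) (n : I -> nat), (0 < N)%N /\ forall i, z i * N%:R = (n i)%:R.
Proof.
move=> z0; exists (\prod_i `|denq (z i)|)%N.
exists (fun i => `|numq (z i)| * \prod_(j | j != i) `|denq (z j)|)%N; split.
  by rewrite prodn_gt0 // => i; rewrite absz_gt0 denq_neq0.
move=> i; rewrite (bigD1 i) //= !natrM mulrA; congr (_ * _).
have numq0 : 0 <= numq (z i) by rewrite numq_ge0.
by rewrite !natr_absz !ger0_norm ?denq_ge0 // numqE.
Qed.

Lemma sum_indicator (R : pzRingType) (I : finType) (P : pred I) (f : I -> R) :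
  \sum_i (P i)%:R * f i = \sum_(i | P i) f i.
Proof. by rewrite [RHS]big_mkcond; apply: eq_bigr => i _; rewrite mulr_natl mulrb. Qed.

(** * Edge cuts *)

Lemma mem_cut (G : sgraph) (F : {set G}) (u v : G) : adj u v ->
  ([set u; v] \in cut F) = ((u \in F) != (v \in F)).
Proof.
move=> uv; apply/imset2P/idP => [[a b aF]|].
  rewrite !inE => /andP[bF ab] /eq_set2[] [-> ->]; rewrite aF ?(negbTE bF) //.
case: (boolP (u \in F)) => uF; case: (boolP (v \in F)) => vF //= _.
  by exists u v; rewrite // !inE vF.
exists v u; [exact: vF| |exact: setUC].
by rewrite !inE uF adj_sym.
Qed.

Lemma cutC (G : sgraph) (F : {set G}) : cut (~: F) = cut F.
Proof.
have sub (K : {set G}) : cut K \subset cut (~: K).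
  apply/subsetP => g /imset2P[a b aK]; rewrite !inE => /andP[bK ab] ->.
  apply/imset2P; exists b a; [by rewrite inE| |exact: setUC].
  by rewrite !inE aK adj_sym.
by apply/eqP; rewrite eqEsubset sub andbT -{2}(setCK F) sub.
Qed.

(** * Weights from linear programming duality *)

Section CutLP.
Variables (G : sgraph) (W : {set G}) (s : nat).

Definition balanced (F : {set G}) := (2 * s <= #|W :&: F|)%N && (2 * s <= #|W :\: F|)%N.

(** Farkas' lemma with one row per vertex load, per balanced cut and per sign constraint.
    Multipliers of the first two kinds become [x] and [y]; those of the third are the slack between
    [cut_dist] and [x u + x v]. *)
Lemma cut_lp (c : rat) :
  (exists a : edge_of G -> rat, [/\ forall g, 0 <= a g,
      forall F, balanced F -> 1 <= \sum_(g : edge_of G | val g \in cut F) a g &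
      forall v, \sum_(g : edge_of G | v \in val g) a g <= c]) \/
  (exists (x : G -> nat) (y : {set G} -> nat), [/\
      forall F, (0 < y F)%N -> balanced F,
      forall u v, adj u v -> (cut_dist y u v <= x u + x v)%N &
      c * (\sum_v x v)%:R < (\sum_F y F)%:R]).
Proof.
pose A (i : G + {set G} + edge_of G) (g : edge_of G) : rat := match i with
  | inl (inl v) => (v \in val g)%:R
  | inl (inr F) => - (balanced F && (val g \in cut F))%:R
  | inr h => - (g == h)%:R end.
pose b (i : G + {set G} + edge_of G) : rat := match i with
  | inl (inl _) => c | inl (inr F) => - (balanced F)%:R | inr _ => 0 end.
have [[a ha]|[z [z0 zA zb]]] := farkas (enum_uniq (edge_of G)) A b.
  left; exists a; split=> [g|F bF|v].
  - have := ha (inr g); rewrite /A /b big_enum /=.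
    under eq_bigr do rewrite mulNr.
    by rewrite sumrN sum_indicator big_pred1_eq oppr_le0.
  - have := ha (inl (inr F)); rewrite /A /b big_enum /= bF /=.
    under eq_bigr do rewrite mulNr.
    by rewrite sumrN sum_indicator lerN2.
  - have := ha (inl (inl v)); rewrite /A /b big_enum /= sum_indicator; exact: id.
right; have [N [n [N0 nz]]] := clear_denominators z0.
have N0' : 0 < N%:R :> rat by rewrite ltr0n.
pose x v := n (inl (inl v)).
(* The row of an unbalanced [F] is void, so its multiplier may be dropped. *)
pose y F := if balanced F then n (inl (inr F)) else 0%N.
have zN f : (\sum_i z i * f i) * N%:R = \sum_v (x v)%:R * f (inl (inl v)) +
    \sum_F (n (inl (inr F)))%:R * f (inl (inr F)) + \sum_g (n (inr g))%:R * f (inr g).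
  rewrite mulr_suml; under eq_bigr do rewrite mulrAC nz.
  by rewrite big_sumType /= big_sumType.
exists x, y; split.
- by move=> F; rewrite /y; case: ifP.
- move=> u v uv.
  have gE : [set u; v] \in edge_set G by apply/imset2P; exists u v; rewrite ?inE.
  pose g : edge_of G := exist _ [set u; v] gE.
  have e1 : \sum_w (x w)%:R * (w \in [set u; v])%:R = (x u + x v)%:R :> rat.
    under eq_bigr do rewrite mulrC.
    rewrite sum_indicator big_setU1 ?big_set1 ?natrD // inE.
    by apply: contraTneq uv => ->; rewrite adj_irr.
  have e2 : \sum_F (n (inl (inr F)))%:R * - (balanced F && ([set u; v] \in cut F))%:R
      = - (cut_dist y u v)%:R :> rat.
    rewrite /cut_dist natr_sum -sumrN; apply: eq_bigr => F _.
    rewrite natrM /y (mem_cut _ uv) mulrN.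
    by case: (balanced F); rewrite ?mulr0 ?mul0r.
  have e3 : \sum_h (n (inr h))%:R * - (g == h)%:R = - (n (inr g))%:R :> rat.
    rewrite (bigD1 g) //= eqxx mulrN1 big1 ?addr0 // => h.
    by rewrite eq_sym => /negbTE->; rewrite oppr0 mulr0.
  have := zN (A^~ g); rewrite zA ?mem_enum // mul0r /A /= e1 e2 e3.
  move=> e; rewrite -(ler_nat rat) -subr_ge0.
  by rewrite (_ : _ - _ = (n (inr g))%:R) ?ler0n //; lra.
- have := zb; rewrite -(pmulr_llt0 _ N0') zN /b /=.
  rewrite [X in _ + X]big1 ?addr0; last by move=> g _; rewrite mulr0.
  under [X in _ + X]eq_bigr do rewrite mulrN.
  rewrite sumrN subr_lt0 -mulr_suml mulrC -natr_sum => h; apply: lt_le_trans h _.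
  rewrite natr_sum; apply: ler_sum => F _; rewrite /y.
  by case: (balanced F); rewrite ?mulr0 ?mulr1.
Qed.

(* The dual solution is a cut metric that spreads [W]; growing regions in it
   yields the separator. *)
Lemma cut_weights_or_separator (L : nat) : (0 < s)%N -> #|W| = (6 * s)%N ->
  (12 * s < 2 ^ L)%N ->
  (exists a : edge_of G -> rat, [/\ forall g, 0 <= a g,
      forall F, balanced F -> 1 <= \sum_(g : edge_of G | val g \in cut F) a g &
      forall v, \sum_(g : edge_of G | v \in val g) a g <= (15 * L)%:R / s%:R]) \/
  exists (S : {set G}) (c : G -> nat), [/\ (#|S| < s)%N,
      forall u v, adj u v -> u \notin S -> v \notin S -> c u = c v &
      forall i, (#|[set v in W | (v \notin S) && (c v == i)]| <= 5 * s)%N].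
Proof.
move=> s0 cW hL; have [|[x [y [yb xy xY]]]] := cut_lp ((15 * L)%:R / s%:R); [by left|right].
have s0' : 0 < s%:R :> rat by rewrite ltr0n.
have {xY} : (15 * L * \sum_v x v < s * \sum_F y F)%N.
  move: xY; rewrite mulrAC ltr_pdivrMr // -!natrM ltr_nat => h.
  by rewrite [X in (_ < X)%N]mulnC.
set X := (\sum_v x v)%N; set Y := (\sum_F y F)%N => XY.
have Y0 : (0 < Y)%N by move: XY; case: (Y) => //; rewrite muln0.
have L0 : (0 < L)%N by case: (L) hL => //; lia.
(* Blocks of [Y] radii reach distance [Y * L], one fifth of the scaled total [5 * L * Y]. Spreading
   with [a = 4 * s] then gives [5 * (#|P| - 4 * s) <= #|P|], that is [#|P| <= 5 * s]. *)
pose x' v := (5 * L * x v)%N; pose y' F := (5 * L * y F)%N.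
have dist' u v : cut_dist y' u v = (5 * L * cut_dist y u v)%N.
  by rewrite /cut_dist big_distrr /=; apply: eq_bigr => F _; rewrite /y' mulnA.
have xy' u v : adj u v -> (cut_dist y' u v <= x' u + x' v)%N.
  by move=> uv; rewrite dist' -mulnDr leq_mul2l xy ?orbT.
have yb' F : (0 < y' F)%N -> (#|W :&: F| <= 4 * s)%N /\ (#|W :\: F| <= 4 * s)%N.
  rewrite /y' muln_gt0 => /andP[_ /yb/andP[]]; have := cardsID F W; lia.
have small (w : G) :
    (#|[set v in W | (cut_dist y' w v < Y * L)%N]| <= 5 * s)%N.
  set P := [set v in W | _]; have PW : P \subset W by apply/subsetP => v; rewrite inE => /andP[].
  have := cut_dist_spread w yb' PW; rewrite -big_distrr /= -/Y => h1.
  have h2 : (\sum_(v in P) cut_dist y' w v <= #|P| * (Y * L))%N.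
    by rewrite -sum_nat_const; apply: leq_sum => v; rewrite inE => /andP[_ /ltnW].
  have := leq_trans h1 h2.
  rewrite (_ : 5 * L * Y * (#|P| - 4 * s) = (5 * (#|P| - 4 * s)) * (Y * L))%N; last by ring.
  rewrite leq_pmul2r ?muln_gt0 ?Y0 // ; lia.
pose X' := (5 * L * X)%N; pose beta := (X' %/ (6 * s))%N.
have sX' : (\sum_v x' v <= X')%N by rewrite -big_distrr.
have hb : (beta + 2 * X' + 1 < 2 ^ L * (beta + 1))%N.
  have h6 : (0 < 6 * s)%N by lia.
  have := ltn_ceil X' h6; rewrite -/beta; have := leq_mul hL (leqnn (beta + 1)); lia.
have [S [c [_ cS adjc cc]]] := region_growing (cut_dist0 y') (cut_dist_triangle y') xy'
   Y0 sX' hb small setT.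
exists S, c; split.
- have : (beta * #|W :&: setT| <= X')%N by rewrite setIT cW leq_trunc_div.
  move: cS; rewrite -big_distrr /=.
  rewrite (eq_bigl xpredT) => [|v]; last by rewrite inE.
  rewrite -(ltn_pmul2r Y0); move: sX' XY; rewrite /X'; lia.
- by move=> u v uv uS vS; apply: adjc => //; rewrite !inE ?uS ?vS.
- move=> i; apply: leq_trans (cc i); apply: subset_leq_card.
  by apply/subsetP => v; rewrite !inE andbT.
Qed.
End CutLP.

(** * From treewidth to branch width, and the constants *)

Lemma tw_cut_weights (G : sgraph) (s L : nat) : (0 < s)%N -> (7 * s <= tw G)%N ->
  (12 * s < 2 ^ L)%N ->
  exists (W : {set G}) (a : edge_of G -> rat), #|W| = (6 * s)%N /\
    [/\ forall g, 0 <= a g,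
      forall F, balanced W s F -> 1 <= \sum_(g : edge_of G | val g \in cut F) a g &
      forall v, \sum_(g : edge_of G | v \in val g) a g <= (15 * L)%:R / s%:R].
Proof.
move=> s0 st hL; apply: boolp.contrapT => no.
suff : (tw G <= (7 * s).-1)%N by lia.
apply: tw_separators => // W cW.
have [[a ha]|//] := cut_weights_or_separator s0 cW hL.
by case: no; exists W, a.
Qed.

Lemma symfun_cutfun (R : realType) (G : sgraph) (a : edge_of G -> R) :
  (forall g, 0 <= a g) -> symfun (cutfun a).
Proof.
move=> a0; split=> F; first by apply: sumr_ge0.
by rewrite /cutfun; apply: eq_bigl => g; rewrite cutC.
Qed.

Lemma branch_width_balanced (R : realType) (E : finType) (q : {set E} -> R)
    (W : {set E}) (s : nat) (w : R) : (0 < s)%N -> #|W| = (6 * s)%N ->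
  (forall F, (2 * s <= #|W :&: F|)%N -> (2 * s <= #|W :\: F|)%N -> w <= q F) ->
  w <= branch_width q.
Proof.
move=> s0 cW hq; have E1 : (1 < #|E|)%N by have := max_card (mem W); rewrite cW; lia.
have [D0] := branch_decomp_exists E1.
have [D [-> _]] := branch_width_min q D0 E1.
have [x [y [xy b1 b2]]] := bd_balanced_edge D s0 cW.
apply: le_trans (hq _ b1 b2) _; rewrite /bd_width.
exact: (le_bigmax_cond _ (fun xy : bd_tree D * bd_tree D => q (bd_side xy.1 xy.2))
  (_ : (fun xy => adj xy.1 xy.2) (x, y))).
Qed.

(** The left side is [20 * L / (3 * s)]; with [k <= 14 * s] and [L * ln 2 <= 3 * ln k] the constant
    becomes [20 * 14 = 280], over [ln 2]. *)
Lemma log_load (R : realType) (k s L : nat) : (8 <= k)%N -> s = (k %/ 7)%N ->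
  L = (trunc_log 2 (12 * s)).+1 ->
  4%:R / 9%:R * ((15 * L)%:R / s%:R) <= 280%:R / ln 2 * (ln k%:R / k%:R) :> R.
Proof.
move=> k8 es eL; have s0 : (0 < s)%N by rewrite es divn_gt0 //; lia.
have ln2 : 0 < ln 2 :> R by rewrite ln_gt0 // ltr1n.
have k0 : 0 < k%:R :> R by rewrite ltr0n; lia.
have s0' : 0 < s%:R :> R by rewrite ltr0n.
have ks : k%:R <= 14%:R * s%:R :> R.
  by rewrite -natrM ler_nat es; have := divn_eq k 7; have := ltn_pmod k (isT : 0 < 7)%N; lia.
have lnk : ln 2 <= ln k%:R :> R by rewrite ler_ln ?posrE ?ltr0n ?ler_nat //; lia.
(* From [2 ^ (L - 1) <= 12 * s <= 2 * k] one gets [L * ln 2 <= 2 * ln 2 + ln k], and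
   [ln 2 <= ln k]. *)
have hL : L%:R * ln 2 <= 3%:R * ln k%:R :> R.
  have h : (2 ^ trunc_log 2 (12 * s) <= 2 * k)%N.
    apply: leq_trans (trunc_logP _ _) _ => //; first by lia.
    by rewrite es; have := leq_trunc_div k 7; lia.
  have : ln ((2 ^ trunc_log 2 (12 * s))%:R) <= ln ((2 * k)%:R) :> R.
    by rewrite ler_ln ?posrE ?ltr0n ?expn_gt0 ?ler_nat //; lia.
  rewrite natrX lnXn // natrM lnM ?posrE ?ltr0n //; last by lia.
  rewrite -mulr_natl eL -addn1 natrD mulrDl mul1r => h'.
  by move: lnk ln2 h'; lra.
have prod : (L%:R * ln 2) * k%:R <= (3%:R * ln k%:R) * (14%:R * s%:R) :> R.
  by apply: ler_pM => //; rewrite mulr_ge0 // ltW.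
have -> : 4%:R / 9%:R * ((15 * L)%:R / s%:R) = (20%:R * L%:R) / (3%:R * s%:R) :> R.
  by rewrite natrM; field; rewrite gt_eqF.
rewrite mulf_div ler_pdivrMr ?mulr_gt0 // mulrAC ler_pdivlMr ?mulr_gt0 //.
lra.
Qed.

Theorem theorem5p13 (R : realType) :
  exists C : R, 0 < C /\
    forall H : hypergraph, (8 <= tw (line_graph H))%N ->
      exists alpha : edge_of (line_graph H) -> R,
        [/\ forall g, 0 <= alpha g,
            symfun (cutfun alpha),
            branch_width (cutfun alpha) >= 4%:R / 9%:R
          & \big[Num.max/0]_(e : hedge H) inc_weight alpha (e : line_graph H)
              <= C * (ln (tw (line_graph H))%:R / (tw (line_graph H))%:R)].
Proof.
exists (280%:R / ln 2); split; first by rewrite divr_gt0 // ln_gt0 // ltr1n.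
move=> H tw8; set k := tw _ in tw8 *.
pose s := (k %/ 7)%N; pose L := (trunc_log 2 (12 * s)).+1.
have s0 : (0 < s)%N by rewrite divn_gt0 //; lia.
have sk : (7 * s <= k)%N by rewrite mulnC leq_trunc_div.
have [W [a [cW [a0 acut ainc]]]] := tw_cut_weights s0 sk (trunc_log_ltn (12 * s) (isT : (1 < 2)%N)).
have r0 : 0 <= 4%:R / 9%:R :> R by rewrite divr_ge0 ?ler0n.
have al0 g : 0 <= 4%:R / 9%:R * ratr (a g) :> R by rewrite mulr_ge0 // ler0q.
have load := log_load R tw8 erefl erefl.
(* Balanced cuts weigh at least 1 under [a], so scaling by 4/9 leaves the required width and lowers
   the load. *)
exists (fun g => 4%:R / 9%:R * ratr (a g)); split=> //.
- exact: symfun_cutfun.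
- apply: branch_width_balanced s0 cW _ => F F1 F2.
  rewrite /cutfun -mulr_sumr -[leLHS]mulr1 ler_wpM2l //.
  have := acut F; rewrite /balanced F1 F2 => /(_ isT).
  by rewrite -(ler_rat R) rmorph1 rmorph_sum.
- apply: bigmax_le => [|e _].
    (* The maximum starts from 0, so the bound itself has to be nonnegative. *)
    by rewrite mulr_ge0 // divr_ge0 // ln_ge0 // ler1n; lia.
  apply: le_trans load; rewrite /inc_weight -mulr_sumr ler_wpM2l // -rmorph_sum /=.
  have := ainc e; rewrite -(ler_rat R) => h; apply: le_trans h _.
  by rewrite fmorph_div /= !ratr_nat.
Qed.
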